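(* Let $G$ be a finite, undirected, simple, connected graph. Then $G$ is an $l^3$-convex geometry if and only if the following three conditions hold: (1) $G$ is chordal; (2) $\mathit{diam}(G)\leq 3$; (3) for every integer $n\geq 4$, every induced $n$-gem contained in $G$ is solved.
   Context: An induced path in $G$ is a path $x_0,\ldots,x_p$ of distinct vertices in which $x_i$ and $x_j$ are adjacent if and only if $|i-j|=1$; its length is $p$, the number of its edges. $G$ is chordal if it contains no induced cycle with at least four vertices. The diameter $\mathit{diam}(G)$ is the maximum distance between two vertices of $G$. Let $k\geq 2$ be an integer. A set $S\subseteq V(G)$ is $l^k$-convex if for every pair of vertices $x,y\in S$, every induced path of $G$ of length at most $k$ connecting $x$ and $y$ has all its vertices in $S$. (The empty set and $V(G)$ are $l^k$-convex.) The $l^k$-convex hull $\mathit{hull}_{l^k}(S)$ of $S\subseteq V(G)$ is the smallest $l^k$-convex set containing $S$, i.e. the intersection of all $l^k$-convex sets of $G$ containing $S$. A vertex $x$ of an $l^k$-convex set $S$ is an extreme point of $S$ if $S\setminus\{x\}$ is also $l^k$-convex; $\mathit{Ext}_{l^k}(S)$ denotes the set of all extreme points of $S$. The graph $G$ is an $l^k$-convex geometry if $\mathit{hull}_{l^k}(\mathit{Ext}_{l^k}(S))=S$ for every $l^k$-convex set $S$ of $G$. Here $k=3$. For $n\geq 3$, an $n$-gem is a graph $G_n$ with vertex set $\{x_0,\ldots,x_n,u_n\}$ such that $x_0,x_1,\ldots,x_n$ is an induced path (with $n$ edges) and $u_n$ is a universal vertex, i.e. adjacent to each of $x_0,\ldots,x_n$.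 If $n\geq 4$ and such a $G_n$ is an induced subgraph of $G$, then $G_n$ is solved if there exists in $G$ an induced path of length exactly three connecting $x_0$ and $x_n$ that does not contain the vertex $u_n$ (the other vertices of this path may be any vertices of $G$, in or outside $G_n$). *)

(* Defs.v *)
From mathcomp Require Import all_boot.

Set Implicit Arguments.
Unset Strict Implicit.
Unset Printing Implicit Defensive.

(* A simple graph is given by its adjacency relation [e] on the finite type [T]
   of its vertices, assumed symmetric and irreflexive. *)
Section Graph.

Variables (T : finType) (e : rel T).

Definition connected_graph := forall x y : T, connect e x y.

(* The sequence [x 0, ..., x p] has [p.+1] vertices, hence length [p]. *)
Definition induced_path (p : nat) (x : 'I_p.+1 -> T) : bool :=
  injectiveb x &&
  [forall i : 'I_p.+1, forall j : 'I_p.+1,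
     e (x i) (x j) == (i.+1 == j :> nat) || (j.+1 == i :> nat)].

(* [ordS] is the cyclic successor on ['I_n]; this describes a cycle only for
   [n >= 3]. *)
Definition induced_cycle (n : nat) (x : 'I_n -> T) : bool :=
  injectiveb x &&
  [forall i : 'I_n, forall j : 'I_n,
     e (x i) (x j) == (j == ordS i) || (i == ordS j)].

Definition chordal : Prop :=
  forall (n : nat) (x : 'I_n -> T), 4 <= n -> ~~ induced_cycle x.

Definition walk_of_length (x y : T) (n : nat) : bool :=
  [exists s : n.-tuple T, path e x s && (last x s == y)].

(* The least length of a walk from [x] to [y]. Connected vertices are joined by
   a walk of length [< #|T|]; the value is [#|T|] when there is no walk. *)
Definition dist (x y : T) : nat := find (walk_of_length x y) (iota 0 #|T|).

Definition diam : nat := \max_(x : T) \max_(y : T) dist x y.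

Definition lk_convex (k : nat) (S : {set T}) : bool :=
  [forall p : 'I_k.+1, forall x : {ffun 'I_p.+1 -> T},
     [&& induced_path x, x ord0 \in S & x ord_max \in S] ==>
     [forall i, x i \in S]].

Definition lk_hull (k : nat) (S : {set T}) : {set T} :=
  \bigcap_(C : {set T} | lk_convex k C && (S \subset C)) C.

(* Meaningful when [S] is convex. *)
Definition lk_Ext (k : nat) (S : {set T}) : {set T} :=
  [set x in S | lk_convex k (S :\ x)].

Definition lk_convex_geometry (k : nat) : Prop :=
  forall S : {set T}, lk_convex k S -> lk_hull k (lk_Ext k S) = S.

(* [x 0, ..., x n, u] induce an [n]-gem with universal vertex [u]; that [u] is
   not one of the [x i] follows from the irreflexivity of [e]. *)
Definition induced_gem (n : nat) (x : 'I_n.+1 -> T) (u : T) : bool :=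
  induced_path x && [forall i, e u (x i)].

Definition gem_solved (n : nat) (x : 'I_n.+1 -> T) (u : T) : Prop :=
  exists y : 'I_4 -> T,
    [/\ induced_path y, y ord0 = x ord0, y ord_max = x ord_max
      & forall i, y i != u].

End Graph.

(* Main.v *)
Require Import Defs.
From mathcomp Require Import all_boot.
From mathcomp Require Import zify.

Set Implicit Arguments.
Unset Strict Implicit.
Unset Printing Implicit Defensive.

(** The theorem splits into two independent facts, both phrased through
monophonic convexity: a set is monophonically convex if it is closed under
induced paths of every length.

For k >= 2, a graph is an l^k-convex geometry exactly when it is chordal and
each of its l^k-convex sets is monophonically convex.  In one direction, an
extreme point of the hull of X lies in X and is simplicial in that hull, so the
hull of X is already generated by the simplicial vertices of X
([geometry_hull_sub]).  An induced cycle of length at least 4 has no such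
vertex, so it cannot occur ([geometry_chordal]); an induced path has at most
its two ends, so it lies in every convex set containing them
([geometry_monophonic]).  In the other direction
([chordal_monophonic_geometry]), let S be convex and H the hull of Ext(S).  If
H is not S, a component C of S minus H is attached to H along a clique, because
two nonadjacent attachments would be joined through C by an induced path, and H
contains all induced paths between its points.  By Dirac's argument
([exists_simplicial]), C contains a vertex that is simplicial in S, hence an
extreme point of S outside H, which is absurd.

For k = 3, in a connected chordal graph, all l^3-convex sets are monophonically
convex exactly when the diameter is at most 3 and long gems are solved.  Both
conditions serve only to show that the ends x, y of an induced path P of length
at least 4 are also joined by an induced path x, a, b, y of length 3
([long_ipath_length3]): x and y are at distance 2 or 3, and at distance 2 the
middle vertex of a shortest path is adjacent to all of P by chordality, so it
forms a gem with P.  The vertices a and b lie in the l^3-hull of x and y, and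
chordality spreads them over P: some interior vertex of P is joined to them by
shorter induced paths, hence is in the hull too, and cuts P into two shorter
paths ([lk3_convex_monophonic]).  Conversely, if x and y are at distance at
least 4, then {x, y} is l^3-convex ([diam_le3]); if they have common neighbours
but no induced path of length 3 between them, then {x, y} together with the
clique of these common neighbours is l^3-convex ([monophonic_gems_solved]).
Neither set contains an induced path of length at least 4 from x to y. *)

(** * Induced paths as sequences *)

Section InducedPaths.

Variables (T : finType) (e : rel T).
Hypotheses (e_sym : symmetric e) (e_irr : irreflexive e).

(** Induced paths as sequences, defined by recursion so that extending,
cutting and concatenating them needs no index arithmetic. *)
Fixpoint ipath (s : seq T) : bool :=
  if s is x :: t then
    ipath t && (if t is y :: t' then
                  e x y && all (fun z => (z != x) && ~~ e x z) t'
                else true)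
  else true.

Lemma ipath_catr s1 s2 : ipath (s1 ++ s2) -> ipath s2.
Proof. by elim: s1 => //= x s IH /andP[/IH]. Qed.

Lemma ipath_catl s1 s2 : ipath (s1 ++ s2) -> ipath s1.
Proof.
elim: s1 => //= x [|y s] IH //= /andP[/IH /= -> /andP[->]] /=.
by rewrite all_cat => /andP[].
Qed.

Lemma ipath_far x z p b : ipath [:: x, z & p] -> b \in p ->
  x != b /\ ~~ e x b.
Proof.
by case/and3P => _ _ /allP H /H /andP[]; rewrite eq_sym.
Qed.

Lemma ipath_cons x z p : e x z ->
  (forall b, b \in p -> x != b /\ ~~ e x b) -> ipath (z :: p) ->
  ipath [:: x, z & p].
Proof.
move=> exz H Hp; rewrite [ipath _]/(ipath (z :: p) && _) Hp exz /=.
by apply/allP => b /H[xb ->]; rewrite eq_sym xb.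
Qed.

Lemma ipath_uniq s : ipath s -> uniq s.
Proof.
elim: s => //= x [|y s] IH //= /andP[/IH /= -> /andP[exy /allP H]].
rewrite andbT inE negb_or; apply/andP; split.
  by apply: contraTneq exy => ->; rewrite e_irr.
by apply/negP => /H; rewrite eqxx.
Qed.

Lemma ipath_path x p : ipath (x :: p) -> path e x p.
Proof. by elim: p x => //= y p IH x /andP[/IH -> /andP[->]]. Qed.

(** With [ipath_of_nth], the link between the recursive definition and the one
that indexes the vertices. *)
Lemma ipath_nth x0 s i j : ipath s -> i < size s -> j < size s ->
  e (nth x0 s i) (nth x0 s j) = (i.+1 == j) || (j.+1 == i).
Proof.
elim: s i j => //= x t IH.
have aux j : ipath (x :: t) -> j < size t -> e x (nth x0 t j) = (j == 0).
  case: t {IH} => [|y t] //= /andP[_ /andP[exy /allP H]].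
  case: j => [|j] //= lt; apply/negbTE.
  by have /andP[] := H _ (mem_nth x0 lt).
move=> [|i] [|j] H Hi Hj.
- by rewrite /= e_irr.
- by rewrite [LHS]aux // orbF eqSS eq_sym.
- by rewrite [LHS]e_sym [LHS]aux //= eqSS eq_sym.
- by rewrite [LHS]IH //; case/andP: H.
Qed.

Lemma ipath_of_nth x0 s : uniq s ->
  (forall i j, i < size s -> j < size s ->
     e (nth x0 s i) (nth x0 s j) = (i.+1 == j) || (j.+1 == i)) ->
  ipath s.
Proof.
elim: s => //= x t IH /andP[xt ut] H.
rewrite IH //=; last by move=> i j Hi Hj; apply: (H i.+1 j.+1).
case: t {IH ut} xt H => [|y t] //= xt H.
rewrite (H 0 1) //=; apply/(all_nthP x0) => i Hi.
rewrite (H 0 i.+2) //= andbT; apply: contraNneq xt => <-.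
by rewrite inE mem_nth // orbT.
Qed.

Lemma ipath_rev s : ipath s -> ipath (rev s).
Proof.
case: s => // x0 s; move: (x0 :: s) => {}s H.
apply: (@ipath_of_nth x0); first by rewrite rev_uniq ipath_uniq.
move=> i j; rewrite size_rev => Hi Hj.
rewrite !nth_rev // ipath_nth //; first lia.
- by rewrite ltn_subrL (leq_ltn_trans _ Hi).
- by rewrite ltn_subrL (leq_ltn_trans _ Hj).
Qed.

Lemma induced_path_nth x p :
  ipath (x :: p) -> induced_path e (fun i : 'I_(size p).+1 => nth x (x :: p) i).
Proof.
move=> H; apply/andP; split.
  apply/injectiveP => i j /eqP; rewrite nth_uniq ?ipath_uniq //.
  by move/eqP/val_inj.
by apply/forallP => i; apply/forallP => j; rewrite ipath_nth.
Qed.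

Lemma ipath_of_induced n (f : 'I_n.+1 -> T) : induced_path e f ->
  exists p, [/\ ipath (f ord0 :: p), size p = n, last (f ord0) p = f ord_max
              & codom f = f ord0 :: p].
Proof.
case/andP=> /injectiveP inj /forallP H.
have sz : size (codom f) = n.+1 by rewrite size_codom card_ord.
have nthE i (Hi : i < n.+1) : nth (f ord0) (codom f) i = f (Ordinal Hi).
  rewrite codomE (nth_map ord0) ?size_enum_ord //; congr f.
  by apply/val_inj; rewrite /= nth_enum_ord.
have : ipath (codom f).
  apply: (@ipath_of_nth (f ord0)); first by apply/injectiveP.
  by move=> i j; rewrite sz => Hi Hj; rewrite !nthE; apply/eqP/(forallP (H _)).
have l0 := nthE 0 isT; have ln := nthE n (ltnSn n).
have m : f (Ordinal (ltnSn n)) = f ord_max by congr f; apply/val_inj.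
have m0 : f (Ordinal (isT : 0 < n.+1)) = f ord0 by congr f; apply/val_inj.
case: (codom f) sz l0 ln {nthE} => //= x p [sz] ->; rewrite m0 m => ln Hp.
by exists p; split=> //; rewrite (last_nth (f ord0)) sz.
Qed.

Lemma split_last (a : pred T) s : has a s ->
  exists s1 x s2, [/\ s = s1 ++ x :: s2, a x & ~~ has a s2].
Proof.
elim: s => //= x s IH; case: (boolP (has a s)) => [/IH [s1 [y [s2 [-> ay h]]]] _|h].
  by exists (x :: s1), y, s2.
by rewrite orbF => ax; exists [::], x, s.
Qed.

(** A walk is shortcut by jumping from [x] to its last neighbour, or to its last
visit of [x]; nothing beyond that point is adjacent to [x]. *)
Lemma walk_ipath x p : path e x p -> exists q,
  [/\ ipath (x :: q), last x q = last x p, {subset q <= p} & size q <= size p].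
Proof.
have [m] := ubnP (size p); elim: m x p => // m IH x p.
case: p => [|y p] lt H; first by exists [::].
have : has (fun z => (z == x) || e x z) (y :: p).
  by move: H => /= /andP[-> _]; rewrite orbT.
case/split_last=> p1 [z [p2 [def_p xz]]] /hasPn far.
rewrite def_p in H lt *; rewrite last_cat /=.
have {H} Hp2 : path e z p2 by move: H; rewrite cat_path /= => /and3P[].
have lt2 : size p2 < m by move: lt; rewrite size_cat /=; lia.
have [q [Hq lq sq zq]] := IH _ _ lt2 Hp2.
case/orP: xz => [/eqP<-|xz].
  exists q; split=> // [w /sq w2|]; last by rewrite size_cat /=; lia.
  by rewrite mem_cat inE w2 !orbT.
exists (z :: q); split=> //=.
- apply: ipath_cons => // b /sq /far; rewrite negb_or => /andP[].
  by rewrite eq_sym.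
- move=> w; rewrite mem_cat !inE => /orP[->|/sq ->]; rewrite !orbT //.
- by rewrite size_cat /=; lia.
Qed.

(** * Chordal graphs *)

(** A vertex adjacent to the two ends of an induced path, and to nothing else
of it, closes the path into an induced cycle. *)
Lemma hole_induced_cycle x p u : ipath (x :: p) -> u \notin x :: p ->
  e u x -> e u (last x p) ->
  (forall z, z \in x :: p -> e u z -> z = x \/ z = last x p) ->
  induced_cycle e (fun i : 'I_(size p).+2 => nth u [:: u, x & p] i).
Proof.
move=> Hp up ux ul far.
have U : uniq (x :: p) := ipath_uniq Hp.
have nth0 : nth u (x :: p) 0 = x by [].
have nthl : nth u (x :: p) (size p) = last x p by rewrite (last_nth u).
have u_nth j : j < (size p).+1 -> e u (nth u (x :: p) j) = (j == 0) || (j == size p).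
  move=> Hj; apply/idP/idP; last by case/orP=> /eqP->; rewrite ?nth0 ?nthl.
  case/(far _ (@mem_nth _ u (x :: p) j Hj)) => /eqP.
    by rewrite -nth0 nth_uniq // => ->.
  by rewrite -nthl nth_uniq // => ->; rewrite orbT.
apply/andP; split.
  apply/injectiveP => i j /eqP; rewrite nth_uniq //=; last by rewrite -/(uniq (x :: p)) up.
  by move/eqP/val_inj.
have ordSE (i j : 'I_(size p).+2) : (j == ordS i) =
   (i == (size p).+1 :> nat) && (j == 0 :> nat)
   || (i != (size p).+1 :> nat) && (j == i.+1 :> nat).
  have -> : (j == ordS i) = (j == i.+1 %% (size p).+2 :> nat) by [].
  case: (eqVneq (i : nat) (size p).+1) => [->|ni]; first by rewrite modnn; lia.
  by have := ltn_ord i => lti; rewrite modn_small; lia.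
apply/forallP => i; apply/forallP => j; rewrite !ordSE; apply/eqP.
case: i j => [[|i] Hi] [[|j] Hj]; rewrite [LHS]/=.
- by rewrite e_irr.
- by rewrite u_nth //=; lia.
- by rewrite e_sym u_nth //=; lia.
- by rewrite ipath_nth //=; lia.
Qed.

(** Between two consecutive neighbours of [u] on the path, a gap would give an
induced cycle of length at least 4.  The induction splits the path at an inner
neighbour of [u] until no such neighbour is left. *)
Lemma nbhd_path_ends x p u : chordal e -> ipath (x :: p) -> u \notin x :: p ->
  e u x -> e u (last x p) -> {in x :: p, forall z, e u z}.
Proof.
move=> ch; have [m] := ubnP (size p); elim: m x p => // m IH x p.
case/lastP: p => [|s y] lt Hp up ux ul z.
  by rewrite inE => /eqP->.
move: ul; rewrite last_rcons => uy.
have [/hasP[w sw uw]|/hasPn far] := boolP (has (e u) s).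
  have {sw} [s1 [s2 def_s]] : exists s1 s2, s = s1 ++ w :: s2.
    by case/splitPr: sw => s1 s2; exists s1, s2.
  subst s.
  have H1 : {in x :: s1 ++ [:: w], forall z, e u z}.
    apply: IH; rewrite ?last_cat //=.
    - by move: lt; rewrite size_rcons !size_cat /=; lia.
    - apply: (@ipath_catl (x :: s1 ++ [:: w]) (rcons s2 y)).
      by move: Hp; rewrite rcons_cat /= -catA.
    - apply: contra up; rewrite !(inE, mem_rcons, mem_cat).
      by case/orP=> [->//|/orP[]->]; rewrite ?orbT.
  have H2 : {in w :: rcons s2 y, forall z, e u z}.
    apply: IH; rewrite ?last_rcons //=.
    - by move: lt; rewrite !size_rcons !size_cat /=; lia.
    - by move: Hp; rewrite rcons_cat -cat_cons; apply: ipath_catr.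
    - apply: contra up; rewrite !(inE, mem_rcons, mem_cat).
      by case/orP=> [->|/orP[]->]; rewrite ?orbT.
  rewrite rcons_cat -cat_cons mem_cat => /orP[zs|/H2//].
  by apply: H1; rewrite -cat_cons mem_cat zs.
case: s lt Hp up far => [|w s] lt Hp up far.
  by rewrite !inE => /orP[] /eqP->.
have ul : e u (last x (rcons (w :: s) y)) by rewrite last_rcons.
have ends v : v \in x :: rcons (w :: s) y -> e u v ->
    v = x \/ v = last x (rcons (w :: s) y).
  rewrite last_rcons inE mem_rcons inE.
  by case/or3P=> [/eqP|/eqP|/far/negP]; auto.
have len : 4 <= (size (rcons (w :: s) y)).+2 by rewrite size_rcons.
have := hole_induced_cycle Hp up ux ul ends.
by move/negbTE: (ch _ (fun i => nth u [:: u, x & rcons (w :: s) y] i)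
  len) => ->.
Qed.

Definition clique (K : {set T}) :=
  forall a b, a \in K -> b \in K -> a != b -> e a b.

Definition simplicial (W : {set T}) v :=
  forall a b, a \in W -> b \in W -> e v a -> e v b -> a != b -> e a b.

Definition component (A : {set T}) (x : T) : {set T} :=
  [set y | connect (fun a b => [&& e a b, a \in A & b \in A]) x y].

Lemma component_root (A : {set T}) x : x \in component A x.
Proof. by rewrite inE connect0. Qed.

Lemma component_sub (A : {set T}) x : x \in A -> component A x \subset A.
Proof.
move=> xA; apply/subsetP => y; rewrite inE => /connectP[p].
elim/last_ind: p => [|p z _]; first by move=> _ ->.
by rewrite rcons_path last_rcons => /andP[_ /and3P[_ _ ?]] ->.
Qed.

Lemma component_closed (A : {set T}) x y z : x \in A ->
  y \in component A x -> z \in A -> e y z -> z \in component A x.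
Proof.
move=> xA yC zA eyz; have yA := subsetP (component_sub xA) _ yC.
move: yC; rewrite !inE => xy; apply: (connect_trans xy).
by apply: connect1; rewrite eyz yA.
Qed.

Lemma component_path (A : {set T}) x y z :
  y \in component A x -> z \in component A x ->
  exists p, [/\ path e y p, last y p = z & {subset p <= component A x}].
Proof.
set r := (fun a b => [&& e a b, a \in A & b \in A]).
have r_sym : symmetric r by move=> a b; rewrite /r e_sym andbCA andbC andbA.
rewrite !inE -/r => xy xz.
have : connect r y z.
  by apply: connect_trans xz; rewrite (sym_connect_sym r_sym).
case/connectP=> p Hp ->; exists p; split=> //.
  by apply: sub_path Hp => a b /and3P[].
move=> w wp; rewrite inE -/r; apply: (connect_trans xy).
by apply: (path_connect Hp); rewrite inE wp orbT.
Qed.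

(** Two nonadjacent vertices attached to the same component are joined by an
induced path through it; the explicit first inner vertex [z] is the witness
that the path does visit the component. *)
Lemma component_link (A : {set T}) x u v c d :
  u != v -> ~~ e u v -> c \in component A x -> d \in component A x ->
  e u c -> e v d ->
  exists z q, [/\ ipath [:: u, z & q], last z q = v, z \in component A x
                & {subset z :: q <= v |: component A x}].
Proof.
move=> uv nuv cC dC uc vd.
have [p [Hp lp sp]] := component_path cC dC.
have : path e u (c :: rcons p v) by rewrite /= uc rcons_path Hp lp e_sym vd.
case/walk_ipath=> [[|z q]] [Hq lq sq _]; move: lq; rewrite /= last_rcons => lq.
  by rewrite lq eqxx in uv.
have sub : {subset z :: q <= v |: component A x}.
  move=> w /sq; rewrite inE mem_rcons in_setU1 inE.
  by case/or3P=> [/eqP->|->//|/sp->]; rewrite ?cC orbT.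
exists z, q; split=> //.
have := sub z (mem_head _ _); rewrite in_setU1 => /orP[/eqP zv|//].
by move: (ipath_path Hq) => /= /andP[]; rewrite zv (negbTE nuv).
Qed.

(** Dirac's theorem on simplicial vertices, relative to a clique [K] that is to
be avoided.  If some [x] outside [K] misses a vertex of [W], the set [S] of
attachments of a component [C] of [W] minus the closed neighbourhood of [x] is
a clique: it lies in the neighbourhood of [x], and an induced path through [C]
between two nonadjacent elements of [S] would have to be entirely adjacent to
[x].  As [S] separates [C] from the rest, a vertex outside [S] that is
simplicial on one side of [S] is simplicial in [W]; the side is chosen so as to
avoid [K], which is a clique and cannot meet both sides. *)
Lemma exists_simplicial (W K : {set T}) : chordal e ->
  clique K -> K \proper W ->
  exists2 v, v \in W :\: K & simplicial W v.
Proof.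
move=> ch; have [m] := ubnP #|W|; elim: m W K => // m IH W K ltW clK.
case/properP=> KW [w wW wK].
have [/existsP[x /andP[]]|] :=
  boolP [exists x in W :\: K, [exists y in W, (y != x) && ~~ e x y]]; last first.
  rewrite negb_exists => /forallP H.
  have univ a b : a \in W -> a \notin K -> b \in W -> a != b -> e a b.
    move=> aW aK bW ab; move: (H a); rewrite inE aK aW /= negb_exists.
    by move/forallP/(_ b); rewrite bW eq_sym ab /= negbK.
  exists w; first by rewrite inE wK.
  move=> a b aW bW _ _ ab.
  have [aK|aK] := boolP (a \in K); last exact: univ.
  have [bK|bK] := boolP (b \in K); first exact: clK.
  by rewrite e_sym univ // eq_sym.
rewrite inE => /andP[xK xW] /existsP[y /and3P[yW yx nxy]].
pose A := [set a in W | (a != x) && ~~ e x a].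
have yA : y \in A by rewrite inE yW yx.
pose C := component A y.
have CA a : a \in C -> [/\ a \in W, a != x & ~~ e x a].
  by move/(subsetP (component_sub yA)); rewrite inE => /and3P[].
pose S := [set s in W :\: C | [exists c in C, e s c]].
have memS s c : s \in W -> s \notin C -> c \in C -> e s c -> s \in S.
  by move=> sW sC cC sc; apply/setIdP; split; [exact/setDP | apply/exists_inP; exists c].
have inS s : s \in S -> [/\ s \in W, s \notin C & exists2 c, c \in C & e s c].
  by case/setIdP => /setDP[sW sC] /exists_inP[c cC sc]; split=> //; exists c.
have xS s : s \in S -> e x s.
  case/inS=> sW sC [c cC sc]; apply: contraNT sC => nxs.
  apply: (@component_closed _ _ c) => //; last by rewrite e_sym.
  rewrite inE sW nxs andbT; apply: contraTneq sc => ->.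
  by case: (CA _ cC).
have clS : clique S.
  move=> a b aS bS ab; apply: contraT => nab.
  have [aW aC [c cC ac]] := inS _ aS; have [bW bC [d dC bd]] := inS _ bS.
  have [z [q [Hq lq zC sq]]] := component_link ab nab cC dC ac bd.
  have xz : ~~ e x z by case: (CA _ zC).
  suff /(_ z) : {in a :: z :: q, forall t, e x t}.
    by rewrite !inE eqxx orbT (negbTE xz) => /(_ isT).
  apply: nbhd_path_ends => //; [|exact: xS|by rewrite /= lq; apply: xS].
  rewrite inE negb_or; apply/andP; split.
    by apply: contraTneq (xS _ aS) => <-; rewrite e_irr.
  apply/negP => /sq; rewrite in_setU1 => /orP[/eqP xb|].
    by have := xS _ bS; rewrite xb e_irr.
  by case/CA; rewrite eqxx.
have xC : x \notin C by apply/negP => /CA[]; rewrite eqxx.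
have xnS : x \notin S by apply/negP => /xS; rewrite e_irr.
have [/exists_inP[k kK kC]|noK] := boolP [exists k in K, k \in C].
(* K meets C, so K lies in C and S, and the side of x avoids it. *)
- have CW : C \subset W by apply/subsetP => a /CA[].
  have lt : #|W :\: C| < m.
    rewrite -ltnS; apply: leq_trans ltW; rewrite ltnS; apply: proper_card.
    apply/properP; split; first exact: subsetDl.
    by exists k; rewrite ?(subsetP KW) // inE kC.
  have pr : S \proper W :\: C.
    apply/properP; split; last by exists x => //; rewrite inE xC.
    by apply/subsetP => s /inS[sW sC _]; rewrite inE sC.
  have [v] := IH _ _ lt clS pr; rewrite !in_setD => /andP[vS /andP[vC vW]] sv.
  exists v.
    rewrite in_setD vW andbT; apply: contra vS => vK.
    apply: (memS _ k) => //; apply: clK => //.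
    by apply: contraNneq vC => ->.
  have noC a : a \in W -> e v a -> a \in W :\: C.
    move=> aW va; rewrite inE aW andbT; apply: contra vS => aC.
    exact: (memS _ a).
  by move=> a b aW bW va vb; apply: sv => //; apply: noC.
(* K misses C, so a simplicial vertex in C is outside K. *)
- have lt : #|C :|: S| < m.
    rewrite -ltnS; apply: leq_trans ltW; rewrite ltnS; apply: proper_card.
    apply/properP; split; last by exists x; rewrite // in_setU negb_or xC.
    by apply/subsetP => s /setUP[/CA[]|/inS[]].
  have pr : S \proper C :|: S.
    apply/properP; split; first exact: subsetUr.
    exists y; first by rewrite in_setU component_root.
    by apply/negP => /xS; apply/negP.
  have [v] := IH _ _ lt clS pr; rewrite in_setD in_setU => /andP[vS].
  rewrite (negbTE vS) orbF => vC sv.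
  have vW : v \in W by case: (CA _ vC).
  exists v.
    rewrite in_setD vW andbT; apply: contra noK => vK.
    by apply/exists_inP; exists v.
  have inCS a : a \in W -> e v a -> a \in C :|: S.
    move=> aW va; rewrite in_setU; have [//|aC] := boolP (a \in C).
    by apply: (memS _ v) => //; rewrite e_sym.
  by move=> a b aW bW va vb; apply: sv => //; apply: inCS.
Qed.

(** * Convex sets, hulls and extreme points *)

Lemma lk_convexP k (S : {set T}) :
  reflect (forall x p, ipath (x :: p) -> size p <= k ->
             x \in S -> last x p \in S -> {subset p <= S})
          (lk_convex e k S).
Proof.
apply: (iffP forallP) => [H x p Hp lep xS lS w wp | H p].
  pose f := [ffun i : 'I_(size p).+1 => nth x (x :: p) i].
  have := forallP (H (Ordinal (lep : size p < k.+1))) f.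
  have -> /= : induced_path e f.
    case/andP: (induced_path_nth Hp) => /injectiveP inj /forallP adj.
    apply/andP; split; first by apply/injectiveP => i j; rewrite !ffunE => /inj.
    by apply/forallP => i; apply/forallP => j; rewrite !ffunE (eqP (forallP (adj i) j)).
  have -> : f ord_max = last x p by rewrite ffunE (last_nth x).
  rewrite ffunE xS lS /= => /forallP fS.
  have lt : (index w p).+1 < (size p).+1 by rewrite ltnS index_mem.
  by have := fS (Ordinal lt); rewrite ffunE /= nth_index.
apply/forallP => f; apply/implyP => /and3P[/ipath_of_induced[q [Hq sq lq cf]] f0 fl].
apply/forallP => i; have : f i \in f ord0 :: q by rewrite -cf codom_f.
rewrite inE => /predU1P[->//|]; apply: (H _ _ Hq) => //; last by rewrite lq.
by rewrite sq -ltnS.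
Qed.

Definition monophonic_convex (S : {set T}) :=
  forall x p, ipath (x :: p) -> x \in S -> last x p \in S -> {subset p <= S}.

Lemma lk_hull_sub k (S : {set T}) : S \subset lk_hull e k S.
Proof. by apply/bigcapsP => C /andP[]. Qed.

Lemma lk_hull_min k (S C : {set T}) :
  lk_convex e k C -> S \subset C -> lk_hull e k S \subset C.
Proof. by move=> cC SC; apply: bigcap_inf; rewrite cC. Qed.

Lemma lk_hull_convex k (S : {set T}) : lk_convex e k (lk_hull e k S).
Proof.
apply/lk_convexP => x p Hp lep /bigcapP xS /bigcapP lS z zp.
apply/bigcapP => C HC; have /andP[/lk_convexP cC _] := HC.
by apply: (cC x p) => //; [apply: xS | apply: lS].
Qed.

Lemma ipath_common_nbr a v b : a != b -> ~~ e a b -> e v a -> e v b -> ipath [:: a; v; b].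
Proof.
move=> ab nab va vb; apply: ipath_cons; first by rewrite e_sym.
  by move=> c; rewrite inE => /eqP->.
by rewrite /= vb.
Qed.

(** Removing an extreme point [v] leaves a convex set, so [v] is not the middle
of an induced path of length 2, which is where [2 <= k] matters. *)
Lemma Ext_simplicial k (S : {set T}) v : 2 <= k -> v \in lk_Ext e k S -> simplicial S v.
Proof.
move=> k2; rewrite inE => /andP[vS /lk_convexP cS] a b aS bS va vb ab.
apply: contraT => nab.
have Sv c : c \in S -> e v c -> c \in S :\ v.
  by move=> cS' vc; rewrite !inE cS' andbT; apply: contraTneq vc => ->; rewrite e_irr.
have := cS a [:: v; b] (ipath_common_nbr ab nab va vb) k2 (Sv _ aS va) (Sv _ bS vb) v.
by rewrite !inE !eqxx => /(_ isT).
Qed.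

(** An interior vertex of an induced path is not simplicial, since its two
neighbours on the path are nonadjacent. *)
Lemma ipath_interior x p v : ipath (x :: p) -> v \in p -> v != last x p ->
  exists a b, [/\ a \in x :: p, b \in x :: p, a != b, ~~ e a b & e v a /\ e v b].
Proof.
move=> Hp vp; case/splitPr: vp Hp => p1 [|b p2] Hp; rewrite last_cat ?eqxx // => _.
case/lastP: p1 Hp => [|p1 a] Hp.
  exists x, b; have [xb nxb] := ipath_far Hp (mem_head _ _).
  split=> //; rewrite ?inE ?eqxx ?orbT //.
  by have := ipath_path Hp; rewrite /= e_sym; case/and3P.
rewrite cat_rcons -cat_cons in Hp.
have Hab := ipath_catr Hp; exists a, b.
have [xb nxb] := ipath_far Hab (mem_head _ _).
split=> //; first by rewrite cat_rcons !(inE, mem_cat) eqxx !orbT.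
  by rewrite cat_rcons !(inE, mem_cat) eqxx !orbT.
by have := ipath_path Hab; rewrite /= e_sym; case/and3P.
Qed.

(** If [x] were not in [X], removing it from the hull of [X] would leave a
smaller convex set containing [X]. *)
Lemma Ext_hull_sub k (X : {set T}) : lk_Ext e k (lk_hull e k X) \subset X.
Proof.
apply/subsetP => x; rewrite inE => /andP[xH cx]; apply: contraT => xX.
have : x \in lk_hull e k X :\ x.
  by apply: subsetP xH; apply: lk_hull_min; rewrite // subsetD1 lk_hull_sub.
by rewrite !inE eqxx.
Qed.

(** * Geometries are the chordal graphs with monophonic convex sets *)

(** In a geometry the simplicial vertices of [X] generate the hull of [X],
because the extreme points of that hull are among them. *)
Lemma geometry_hull_sub k (X Y : {set T}) : 2 <= k -> lk_convex_geometry e k ->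
  (forall v, v \in X -> simplicial X v -> v \in Y) ->
  lk_convex e k Y -> X \subset Y.
Proof.
move=> k2 geo H cY; apply: (subset_trans (lk_hull_sub k X)).
rewrite -(geo _ (lk_hull_convex k X)); apply: lk_hull_min => //.
apply/subsetP => v vE; apply: H; first exact: subsetP (Ext_hull_sub _ _) _ vE.
have sv := Ext_simplicial k2 vE.
by move=> a b aX bX; apply: sv; apply: subsetP (lk_hull_sub _ _) _ _.
Qed.

(** No vertex of an induced cycle of length at least 4 is simplicial in it, so
such a cycle would lie in the hull of the empty set, which is empty. *)
Lemma geometry_chordal k : 2 <= k -> lk_convex_geometry e k -> chordal e.
Proof.
move=> k2 geo n f n4; apply/negP => /andP[/injectiveP inj /forallP adj].
have adjE i j : e (f i) (f j) = (j == ordS i) || (i == ordS j).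
  exact: eqP (forallP (adj i) j).
have i0 : 'I_n by apply: (Ordinal (_ : 0 < n)); apply: leq_trans n4.
suff : codom f \subset (set0 : {set T}).
  by move/subsetP/(_ _ (codom_f f i0)); rewrite inE.
have -> : (codom f \subset (set0 : {set T})) = ([set x in codom f] \subset set0).
  by apply: eq_subset => x; rewrite inE.
apply: (geometry_hull_sub k2 geo); last first.
  by apply/lk_convexP => x p _ _; rewrite inE.
move=> v; rewrite inE => /codomP[j ->] sv.
set i := ord_pred j; have ji : j = ordS i by rewrite ord_predK.
have ordSE (h : 'I_n) :
    (h.+1 < n) && (ordS h == h.+1 :> nat) || (h.+1 == n) && (ordS h == 0 :> nat).
  have [lt|] := ltnP h.+1 n; first by rewrite /= modn_small // eqxx.
  have := ltn_ord h => lth len; rewrite /=; have -> : h.+1 = n by lia.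
  by rewrite /= modnn !eqxx.
have [[o1 o2] o3] := (ordSE i, ordSE (ordS i), ordSE (ordS (ordS i))).
have ab : i != ordS (ordS i) :> nat by lia.
have : e (f i) (f (ordS (ordS i))).
  apply: sv; rewrite ?inE ?codom_f ?adjE ?ji ?eqxx ?orbT //.
  by apply: contraNneq ab => /inj <-.
by rewrite adjE => /orP[] /eqP/(congr1 (@nat_of_ord n)) h; lia.
Qed.

(** Only the ends of an induced path can be simplicial in it, so the ends
generate the path. *)
Lemma geometry_monophonic k (S : {set T}) : 2 <= k -> lk_convex_geometry e k ->
  lk_convex e k S -> monophonic_convex S.
Proof.
move=> k2 geo cS x p Hp xS lS z zp.
have sub : [set y in x :: p] \subset S.
  apply: (geometry_hull_sub k2 geo) => // v; rewrite inE in_cons => /predU1P[->//|vp] sv.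
  have [->//|vl] := eqVneq v (last x p).
  have [a [b [aP bP ab nab [va vb]]]] := ipath_interior Hp vp vl.
  by case/negP: nab; apply: sv; rewrite ?inE // -topredE.
by apply: (subsetP sub); rewrite inE in_cons zp orbT.
Qed.

(** An induced path inside [S] can only end at a simplicial vertex, never pass
through it. *)
Lemma simplicial_Ext k (S : {set T}) v : lk_convex e k S -> v \in S ->
  simplicial S v -> v \in lk_Ext e k S.
Proof.
move=> cS vS sv; rewrite inE vS; apply/lk_convexP => x p Hp lep.
rewrite !in_setD1 => /andP[xv xS] /andP[lv lS] z zp.
have pS : {subset x :: p <= S}.
  by move=> w; rewrite inE => /predU1P[->//|]; apply: (lk_convexP _ _ cS x p).
rewrite in_setD1 pS ?inE ?zp ?orbT // andbT.
apply: contraTneq zp => ->; apply/negP => vp.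
rewrite eq_sym in lv; have [a [b [aP bP ab /negP nab [va vb]]]] := ipath_interior Hp vp lv.
by apply: nab; apply: sv => //; apply: pS.
Qed.

(** A vertex of [S] missing from the hull [H] of its extreme points spans a
component [C] of [S] minus [H] whose attachments [K] form a clique by monophonic
convexity; a simplicial vertex of [C] with [K] that avoids [K] is an extreme
point of [S] outside [H]. *)
Lemma chordal_monophonic_geometry k : chordal e ->
  (forall S, lk_convex e k S -> monophonic_convex S) -> lk_convex_geometry e k.
Proof.
move=> ch mono S cS; set H := lk_hull e k _.
have HS : H \subset S.
  by apply: lk_hull_min => //; apply/subsetP => v; rewrite inE => /andP[].
apply/eqP; rewrite eqEsubset HS; apply/subsetP => x xS; apply: contraT => xH.
have mH := mono _ (lk_hull_convex k (lk_Ext e k S)); rewrite -/H in mH.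
have xA : x \in S :\: H by rewrite inE xH.
pose C := component (S :\: H) x.
have CA a : a \in C -> a \in S /\ a \notin H.
  by move/(subsetP (component_sub xA)) => /setDP.
pose K := [set h in H | [exists c in C, e h c]].
have inK h : h \in K -> h \in H /\ exists2 c, c \in C & e h c.
  by case/setIdP => hH /exists_inP.
have clK : clique K.
  move=> a b /inK[aH [c cC ac]] /inK[bH [d dC bd]] ab; apply: contraT => nab.
  have [z [q [Hq lq zC _]]] := component_link ab nab cC dC ac bd.
  have [_ /negP[]] := CA _ zC.
  by apply: (mH _ _ Hq) => //; rewrite ?mem_head //= lq.
have pr : K \proper C :|: K.
  apply/properP; split; first exact: subsetUr.
  exists x; first by rewrite in_setU component_root.
  by apply: contra xH => /inK[].
have [v] := exists_simplicial ch clK pr; rewrite in_setD in_setU => /andP[vK].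
rewrite (negbTE vK) orbF => vC sv; have [vS /negP[]] := CA _ vC.
apply: (subsetP (lk_hull_sub k _)); apply: simplicial_Ext => //.
have inCK a : a \in S -> e v a -> a \in C :|: K.
  move=> aS va; rewrite in_setU; have [aH|aH] := boolP (a \in H).
    apply/orP; right; apply/setIdP; split=> //; apply/exists_inP; exists v => //.
    by rewrite e_sym.
  by rewrite (component_closed xA vC) // inE aH.
by move=> a b aS bS va vb; apply: sv => //; apply: inCK.
Qed.

(** * Distance *)

Lemma walkP x y n : reflect (exists p, [/\ path e x p, last x p = y & size p = n])
  (walk_of_length e x y n).
Proof.
apply: (iffP existsP) => [[p /andP[Hp /eqP lp]]|[p [Hp lp sp]]].
  by exists p; rewrite size_tuple.
by have /eqP sz := sp; exists (Tuple sz); rewrite /= Hp lp /=.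
Qed.

Lemma dist_ipath_le x p : ipath (x :: p) -> dist e x (last x p) <= size p.
Proof.
move=> Hp; have lt : size p < #|T|.
  by rewrite -[(size p).+1]/(size (x :: p)) -(card_uniqP (ipath_uniq Hp)) max_card.
rewrite leqNgt; apply/negP => /(before_find 0); rewrite nth_iota // => /walkP[].
by exists p; rewrite (ipath_path Hp).
Qed.

Lemma dist_walk x y : connect e x y ->
  exists p, [/\ path e x p, last x p = y & size p = dist e x y].
Proof.
case/connectP=> p /walk_ipath[q [Hq lq _ _]] ->; apply/walkP.
have lt : size q < #|T|.
  by rewrite -[(size q).+1]/(size (x :: q)) -(card_uniqP (ipath_uniq Hq)) max_card.
have hw : has (walk_of_length e x (last x p)) (iota 0 #|T|).
  apply/hasP; exists (size q); first by rewrite mem_iota.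
  by apply/walkP; exists q; rewrite (ipath_path Hq).
have := nth_find 0 hw; rewrite nth_iota //.
by move: hw; rewrite has_find size_iota.
Qed.

(** * Convex sets for induced paths of length at most 3 *)

Definition gems_solved := forall n (x : 'I_n.+1 -> T) u,
  4 <= n -> induced_gem e x u -> gem_solved e x u.

(** A shortest path between the ends has length 2 or 3.  At length 2 its middle
vertex is adjacent to the whole of the given path by chordality, and the
resulting gem is solved. *)
Lemma long_ipath_length3 x p : connected_graph e -> chordal e -> diam e <= 3 ->
  gems_solved -> ipath (x :: p) -> 4 <= size p ->
  exists a b, ipath [:: x; a; b; last x p].
Proof.
move=> conn ch d3 gems Hp p4.
have dxy : dist e x (last x p) <= 3.
  apply: leq_trans d3; apply: leq_trans (leq_bigmax x).
  by apply: (leq_bigmax (F := dist e x)).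
have [w [/walk_ipath[q [Hq lq _ sq]] lw sw]] := dist_walk (conn x (last x p)).
rewrite lw in lq; rewrite sw in sq; have {sw sq dxy} q3 := leq_trans sq dxy.
have [z [r def_p]] : exists z r, p = z :: r by case: (p) p4 => // z r; exists z, r.
have ly : last x p \in r.
  by rewrite def_p in p4 *; case: (r) p4 => [|d t] //= _; apply: mem_last.
have [xl nxl] : x != last x p /\ ~~ e x (last x p).
  by apply: (@ipath_far x z r) ly; rewrite -def_p.
have xa_nin a : e a x -> e a (last x p) -> a \notin x :: p.
  move=> ax al; rewrite inE negb_or; apply/andP; split.
    by apply: contraTneq ax => ->; rewrite e_irr.
  rewrite def_p; apply/negP; rewrite inE => /predU1P[az|ar]; last first.
    have [] := @ipath_far x z r a _ ar; first by rewrite -def_p.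
    by rewrite e_sym ax.
  have Hz : ipath (z :: r) by move: Hp; rewrite def_p => /(@ipath_catr [:: x]).
  case: r def_p ly Hz => // d [|d' t] def_p ly Hz; first by rewrite def_p in p4.
  have lt : last x p \in d' :: t by rewrite def_p /= mem_last.
  by have [] := ipath_far Hz lt; rewrite -az al.
case: q Hq lq q3 => [|a [|b [|b' [|? ?]]]] // Hq lq _.
- by rewrite -lq eqxx in xl.
- by case/negP: nxl; rewrite -lq; have /andP[] := ipath_path Hq.
(* The middle vertex a of the shortest path is adjacent to the whole path. *)
- have := ipath_path Hq; rewrite /= -[b]/(last x [:: a; b]) lq => /and3P[xa al _].
  rewrite e_sym in xa.
  pose f (i : 'I_(size p).+1) := nth x (x :: p) i.
  have gem : induced_gem e f a.
    rewrite /induced_gem (induced_path_nth Hp); apply/forallP => i.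
    apply: (nbhd_path_ends ch Hp (xa_nin a xa al)) => //.
    exact: mem_nth.
  have [g [/ipath_of_induced[[|c [|d [|b' [|? ?]]]] [] // Hg _ lg _] g0 g3 _]] := gems _ f a p4 gem.
  exists c, d; move: Hg lg; rewrite /= g0 g3 => Hg lg.
  by have -> : last x p = b' by rewrite lg /f (last_nth x).
- by exists a, b; rewrite -lq.
Qed.

(** By induction on the length, it suffices to find one interior vertex of the
path [P] in [S], as it cuts [P] into two shorter induced paths.  Let
[x; a; b; y] be the induced path of length 3 between the ends of [P].  If [a]
and [b] are both off [P], the interior vertex is the last neighbour [z] of [a]
on [P].  The path from [a] through [z] along [P] is induced and shorter than [P]
unless [z] is the second vertex of [P]; in that case, [z] is adjacent to [b] by
chordality, and lies on the induced path [x; z; b] of length 2. *)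
Lemma lk3_convex_monophonic (S : {set T}) : chordal e ->
  (forall x p, ipath (x :: p) -> 4 <= size p ->
     exists a b, ipath [:: x; a; b; last x p]) ->
  lk_convex e 3 S -> monophonic_convex S.
Proof.
move=> ch short /lk_convexP cS x p.
have [m] := ubnP (size p); elim: m x p => // m IH x p ltm Hp xS lS.
have [le3|p4] := leqP (size p) 3; first exact: cS Hp le3 xS lS.
(* Such a z cuts the path into two shorter ones with ends in S. *)
have split z : z \in x :: p -> z != x -> z != last x p -> z \in S ->
    {subset p <= S}.
  rewrite inE => /orP[/eqP->|]; first by rewrite eqxx.
  move=> zp; have [p1 [p2 def_p]] : exists p1 p2, p = p1 ++ z :: p2.
    by case/splitPr: zp => p1 p2; exists p1, p2.
  rewrite def_p last_cat in ltm Hp lS *.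
  case: p2 {def_p} => [|b p2] in ltm Hp lS *; first by rewrite eqxx.
  move=> _ _ zS w; rewrite size_cat /= in ltm.
  rewrite -cat_rcons mem_cat => /orP[w1|w2].
    apply: (IH x (rcons p1 z)); rewrite ?last_rcons ?size_rcons //; first lia.
    by move: Hp; rewrite -cat_rcons -cat_cons; apply: ipath_catl.
  apply: (IH z (b :: p2)) => //=; first lia.
  by move: Hp; rewrite -cat_cons; apply: ipath_catr.
have [a [b Hab]] := short _ _ Hp p4.
set y := last x p in lS Hab split.
have abS : {subset [:: a; b; y] <= S} by apply: cS Hab _ xS lS.
have [aS bS] : a \in S /\ b \in S by split; apply: abS; rewrite !inE eqxx ?orbT.
have [xb nxb] : x != b /\ ~~ e x b by apply: ipath_far Hab _; rewrite inE eqxx.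
have [ay nay] : a != y /\ ~~ e a y.
  by apply: (@ipath_far a b [:: y]); [exact: ipath_catr [:: x] _ Hab | rewrite inE].
have /and4P[xa ab by' _] := ipath_path Hab.
have ax : a != x by apply: contraTneq xa => ->; rewrite e_irr.
have yb : b != y by apply: contraTneq by' => ->; rewrite e_irr.
have [ap|ap] := boolP (a \in x :: p); first exact: (split a).
have [bp|bp] := boolP (b \in x :: p); first by apply: (split b); rewrite // eq_sym.
have : has (e a) (x :: p) by rewrite /= e_sym xa.
case/split_last=> s1 [z [s2 [def_p az /hasPn far]]].
have zp : z \in x :: p by rewrite def_p mem_cat mem_head orbT.
have lz : last z s2 = y by rewrite /y -[RHS]/(last x (x :: p)) def_p last_cat.
have Hz : ipath (z :: s2) by apply: (@ipath_catr s1); rewrite -def_p.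
have sub2 : {subset z :: s2 <= x :: p} by move=> t; rewrite def_p mem_cat orbC => ->.
have Haz : ipath [:: a, z & s2].
  apply: ipath_cons => // t ts; split; last exact: far.
  by apply: contraNneq ap => ->; apply: sub2; rewrite inE ts orbT.
have bz : e b z.
  apply: (nbhd_path_ends ch Haz); rewrite /= ?lz //; last by rewrite !inE eqxx orbT.
    rewrite inE negb_or; apply/andP; split; last by apply: contra bp; apply: sub2.
    by apply: contraTneq ab => ->; rewrite e_irr.
  by rewrite e_sym.
have zx : z != x by apply: contraNneq nxb => <-; rewrite e_sym.
have zy : z != y by apply: contraNneq nay => <-.
apply: (split z) => //.
case: s1 def_p => [|x' [|c s1]] [] => [xz|_ def_p|_ def_p]; first by rewrite xz eqxx in zx.
- have xz : e x z by have := ipath_path Hp; rewrite def_p /= => /andP[].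
  apply: (cS x [:: z; b]); rewrite ?mem_head //.
  by apply: ipath_common_nbr => //; rewrite e_sym.
- apply: (IH a (z :: s2)); rewrite ?mem_head //=; last by rewrite lz.
  by rewrite -ltnS; apply: leq_trans ltm; rewrite def_p /= size_cat /= addnS !ltnS leq_addl.
Qed.

Lemma ipath_reverse x p : ipath (x :: p) ->
  exists q, [/\ ipath (last x p :: q), last (last x p) q = x & size q = size p].
Proof.
move=> Hp; exists (rev (belast x p)); split.
- by rewrite -rev_rcons -lastI ipath_rev.
- by case: p {Hp} => //= y p; rewrite rev_cons last_rcons.
- by rewrite size_rev size_belast.
Qed.

Lemma ipath_closed x p : ipath (x :: p) -> last x p = x -> p = [::].
Proof.
case: p => // y p /ipath_uniq /= /andP[xp _] lp; move: xp.
by rewrite -[X in X \notin _]lp mem_last.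
Qed.

(** Two vertices at distance at least 4 form an l^3-convex pair, which cannot
contain the induced path that joins them. *)
Lemma diam_le3 : connected_graph e ->
  (forall S : {set T}, lk_convex e 3 S -> monophonic_convex S) -> diam e <= 3.
Proof.
move=> conn mono; apply/bigmax_leqP => x _; apply/bigmax_leqP => y _.
rewrite leqNgt; apply/negP => dxy.
have far p : ipath (x :: p) -> last x p = y -> 4 <= size p.
  by move=> Hp lp; apply: leq_trans dxy _; rewrite -lp dist_ipath_le.
have [p [/walk_ipath[q [Hq lq _ _]] lp _]] := dist_walk (conn x y).
rewrite lp in lq; have q4 := far _ Hq lq.
have conv : lk_convex e 3 [set x; y].
  apply/lk_convexP => a r Hr r3.
  rewrite !in_set2 => /orP[]/eqP ea /orP[]/eqP lr; subst a.
  - by rewrite (ipath_closed Hr lr).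
  - by have := far _ Hr lr; rewrite leqNgt ltnS r3.
  - have [t [Ht lt st]] := ipath_reverse Hr; rewrite lr in Ht lt.
    by have := far _ Ht lt; rewrite leqNgt ltnS st r3.
  - by rewrite (ipath_closed Hr lr).
have sub : {subset q <= [set x; y]}.
  by apply: (mono _ conv _ _ Hq); rewrite ?lq in_set2 eqxx ?orbT.
have U := ipath_uniq Hq.
have := max_card (mem (x :: q)); rewrite (card_uniqP U).
have : #|x :: q| <= #|[set x; y]|.
  apply/subset_leq_card/subsetP => z.
  by rewrite inE => /predU1P[->|/sub//]; rewrite in_set2 eqxx.
by rewrite (card_uniqP U) cards2 /=; case: (x != y); lia.
Qed.

(** If the ends [x] and [y] of the gem's path are not joined by an induced path
of length 3, then [x] and [y] with their common neighbours form an l^3-convex set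
[Q]: the common neighbours are a clique, so induced paths of length at least 2
in the graph between points of [Q] join [x] to [y].  The second vertex of the
gem's path is not in [Q], being nonadjacent to [y].  A path of length 3 from [x]
to [y] avoids [u] automatically, as no vertex of it is adjacent to both ends. *)
Lemma monophonic_gems_solved : chordal e ->
  (forall S : {set T}, lk_convex e 3 S -> monophonic_convex S) -> gems_solved.
Proof.
move=> ch mono n f u n4 /andP[/ipath_of_induced[p [Hp sp lp _]] /forallP uf].
have := uf ord0; have := uf ord_max; rewrite /gem_solved.
move: (f ord0) (f ord_max) Hp lp => x y Hp lp uy ux {uf f}.
have {sp n4} p4 : 4 <= size p by rewrite sp.
have [/existsP[z /existsP[w H]]|none] :=
    boolP [exists z, exists w, ipath [:: x; z; w; y]].
  have [xy nxy] : x != y /\ ~~ e x y by apply: ipath_far H _; rewrite !inE eqxx orbT.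
  have [xw nxw] : x != w /\ ~~ e x w by apply: ipath_far H _; rewrite !inE eqxx.
  have [zy nzy] : z != y /\ ~~ e z y.
    by apply: (ipath_far (@ipath_catr [:: x] _ H)); rewrite inE.
  exists (fun i : 'I_4 => nth x [:: x; z; w; y] i).
  split=> //; first exact: induced_path_nth H.
  move=> i; have : nth x [:: x; z; w; y] i \in [:: x; z; w; y] by apply: mem_nth.
  rewrite !inE => /or4P[] /eqP ->; rewrite eq_sym.
  - by apply: contraTneq ux => ->; rewrite e_irr.
  - by apply: contraTneq uy => ->.
  - by apply: contraTneq ux => ->; rewrite e_sym.
  - by apply: contraTneq uy => ->; rewrite e_irr.
exfalso.
pose I := [set z | e x z && e z y].
have [xy nxy] : x != y /\ ~~ e x y.
  case: p Hp lp p4 => [|c [|d t]] // Hp lp _.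
  by apply: (ipath_far Hp); rewrite -lp /= mem_last.
have clI : clique I.
  move=> a b; rewrite !inE => /andP[xa ay] /andP[xb yb] ab; apply: contraT => nab.
  have /(_ x) : {in [:: a; x; b], forall t, e y t}.
    apply: (@nbhd_path_ends a [:: x; b] y ch (ipath_common_nbr ab nab xa xb)); last first.
    - by rewrite /= e_sym.
    - by rewrite e_sym.
    rewrite !inE !negb_or; apply/and3P; split.
    - by apply: contraTneq ay => ->; rewrite e_irr.
    - by rewrite eq_sym.
    - by apply: contraTneq yb => ->; rewrite e_irr.
  by rewrite !inE eqxx orbT e_sym (negbTE nxy) => /(_ isT).
pose Q := [set x; y] :|: I.
have inQ z : z \in Q -> [\/ z = x, z = y | z \in I].
  by rewrite in_setU in_set2 => /orP[/orP[]/eqP|]; [constructor 1|constructor 2|constructor 3].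
have xQ : x \in Q by rewrite in_setU in_set2 eqxx.
have yQ : y \in Q by rewrite in_setU in_set2 eqxx orbT.
have IQ z : z \in I -> z \in Q by rewrite in_setU => ->; rewrite orbT.
have far_ends a b : a \in Q -> b \in Q -> a != b -> ~~ e a b ->
    (a = x /\ b = y) \/ (a = y /\ b = x).
  move=> /inQ[->|->|aI] /inQ[->|->|bI]; rewrite ?eqxx //; auto.
  - by move: bI; rewrite inE => /andP[->].
  - by move: bI; rewrite inE => /andP[_ yb] _; rewrite e_sym yb.
  - by move: aI; rewrite inE => /andP[xa _] _; rewrite e_sym xa.
  - by move: aI; rewrite inE => /andP[_ ->].
  - by move=> ab; rewrite clI.
have conv : lk_convex e 3 Q.
  apply/lk_convexP => a [|z [|b [|c [|? ?]]]] // Hr _ aQ lQ t.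
  - by rewrite inE => /eqP->.
  - have [ab nab] : a != b /\ ~~ e a b by apply: ipath_far Hr _; rewrite inE.
    rewrite in_cons mem_seq1 => /orP[/eqP->|/eqP->//]; apply: IQ.
    have /and3P[az zb _] := ipath_path Hr; rewrite inE.
    case: (far_ends a b aQ lQ ab nab) => [[ax yE]|[ay xE]]; subst; first by rewrite az.
    by rewrite e_sym zb e_sym.
  - have [ab nab] : a != c /\ ~~ e a c by apply: ipath_far Hr _; rewrite !inE eqxx orbT.
    case: (far_ends a c aQ lQ ab nab) => [[ax cy]|[ay cx]]; subst.
      by case/negP: none; apply/existsP; exists z; apply/existsP; exists b.
    have /= Hr' := ipath_rev Hr.
    by case/negP: none; apply/existsP; exists b; apply/existsP; exists z.
have sub : {subset p <= Q} by apply: (mono _ conv _ _ Hp); rewrite ?lp.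
case: p Hp lp p4 sub => [|c [|d [|d' t]]] // Hp lp _ sub.
have yt : y \in d' :: t by rewrite -lp /= mem_last.
have [cy ncy] : c != y /\ ~~ e c y by apply: ipath_far (@ipath_catr [:: x] _ Hp) yt.
have xc : x != c by have /= := ipath_uniq Hp; rewrite inE negb_or -andbA => /andP[].
case: (inQ c (sub _ (mem_head _ _))) => [cx|cy'|].
- by rewrite cx eqxx in xc.
- by rewrite cy' eqxx in cy.
- by rewrite inE (negbTE ncy) andbF.
Qed.

End InducedPaths.

Theorem theorem2 (T : finType) (e : rel T)
    (e_sym : symmetric e) (e_irr : irreflexive e)
    (e_conn : connected_graph e) :
  lk_convex_geometry e 3 <->
  [/\ chordal e,
      diam e <= 3
    & forall (n : nat) (x : 'I_n.+1 -> T) (u : T),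
        4 <= n -> induced_gem e x u -> gem_solved e x u].
Proof.
split=> [geo | [ch d3 gems]].
  have ch := geometry_chordal e_sym e_irr (isT : 2 <= 3) geo.
  have mono S := geometry_monophonic (S := S) e_sym e_irr (isT : 2 <= 3) geo.
  split=> //; first exact: diam_le3.
  exact: monophonic_gems_solved.
apply: chordal_monophonic_geometry => // S.
apply: lk3_convex_monophonic => // x p.
exact: long_ipath_length3.
Qed.
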